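(* Let $R = C[0,1]$ be the ring of continuous functions $f:[0,1]\to\mathbb{R}$ under pointwise addition and multiplication. Let $P$ be a prime ideal of $R$ that is not a maximal ideal. Then there is a unique maximal ideal of $R$ containing $P$; this maximal ideal is of the form $M_\gamma$ for some $\gamma\in[0,1]$, and the containment $P \subsetneq M_\gamma$ is strict.
   Context: For $\gamma \in [0,1]$, $M_\gamma = \{f \in R : f(\gamma) = 0\}$. Prime ideals are proper by definition. *)

(* Defs.v *)
From HB Require Import structures.
From mathcomp Require Import all_boot all_order all_algebra.
From mathcomp Require Import ring_quotient.
From mathcomp Require Import all_classical all_reals all_analysis.

Set Implicit Arguments.
Unset Strict Implicit.
Unset Printing Implicit Defensive.

Import Order.TTheory GRing.Theory Num.Theory.
Import numFieldNormedType.Exports.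

Local Open Scope classical_set_scope.
Local Open Scope ring_scope.

(* A [set_type], not a [subspace]: functions on [subspace A] are also defined,
   and unconstrained, outside A. *)
Definition unit_itv (R : realType) : topologicalType :=
  set_type (`[0, 1]%classic : set R).

Definition C01 (R : realType) : Type := continuousType (unit_itv R) R.

HB.instance Definition _ (R : realType) := Choice.on (C01 R).

Section C01_ring.
Context {R : realType}.
Implicit Types f g h : C01 R.

Lemma C01_cts f : continuous f.
Proof. exact: (@cts_fun _ _ f). Qed.

Lemma C01_eqP f g : f =1 g -> f = g.
Proof. by move=> fg; apply/continuousEP. Qed.

Lemma C01_add_cts f g : continuous (fun x => f x + g x).
Proof. by move=> x; exact: (cvgD (@C01_cts f x) (@C01_cts g x)). Qed.

Lemma C01_opp_cts f : continuous (fun x => - f x).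
Proof. by move=> x; exact: (cvgN (@C01_cts f x)). Qed.

Lemma C01_mul_cts f g : continuous (fun x => f x * g x).
Proof. by move=> x; exact: (cvgM (@C01_cts f x) (@C01_cts g x)). Qed.

Definition C01_const (a : R) : C01 R := cst a.
Definition C01_add f g : C01 R := mkcts (@C01_add_cts f g).
Definition C01_opp f : C01 R := mkcts (@C01_opp_cts f).
Definition C01_mul f g : C01 R := mkcts (@C01_mul_cts f g).

Lemma C01_addA : associative C01_add.
Proof. by move=> f g h; apply: C01_eqP => x; exact: addrA. Qed.

Lemma C01_addC : commutative C01_add.
Proof. by move=> f g; apply: C01_eqP => x; exact: addrC. Qed.

Lemma C01_add0 : left_id (C01_const 0) C01_add.
Proof. by move=> f; apply: C01_eqP => x; exact: add0r. Qed.

Lemma C01_addN : left_inverse (C01_const 0) C01_opp C01_add.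
Proof. by move=> f; apply: C01_eqP => x; exact: addNr. Qed.

Lemma C01_mulA : associative C01_mul.
Proof. by move=> f g h; apply: C01_eqP => x; exact: mulrA. Qed.

Lemma C01_mulC : commutative C01_mul.
Proof. by move=> f g; apply: C01_eqP => x; exact: mulrC. Qed.

Lemma C01_mul1 : left_id (C01_const 1) C01_mul.
Proof. by move=> f; apply: C01_eqP => x; exact: mul1r. Qed.

Lemma C01_mulDl : left_distributive C01_mul C01_add.
Proof. by move=> f g h; apply: C01_eqP => x; exact: mulrDl. Qed.

Lemma zero_in_unit_itv : (0 : R) \in (`[0, 1]%classic : set R).
Proof. by apply/mem_set; rewrite /= in_itv /= lexx ler01. Qed.

Lemma C01_oner_neq0 : C01_const 1 != C01_const 0.
Proof.
apply/eqP => /continuousEP /(_ (SigSub zero_in_unit_itv)) /eqP.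
by rewrite /= oner_eq0.
Qed.

End C01_ring.

HB.instance Definition _ (R : realType) :=
  GRing.isZmodule.Build (C01 R) (@C01_addA R) (@C01_addC R) (@C01_add0 R)
    (@C01_addN R).

HB.instance Definition _ (R : realType) :=
  GRing.Zmodule_isComNzRing.Build (C01 R) (@C01_mulA R) (@C01_mulC R)
    (@C01_mul1 R) (@C01_mulDl R) (@C01_oner_neq0 R).

(* [idealr_closed] already requires properness (1 is not in the ideal). *)
Definition prime_ideal (A : comNzRingType) (P : set A) : Prop :=
  idealr_closed [in P] /\ prime_idealr_closed [in P].

Definition maximal_ideal (A : comNzRingType) (M : set A) : Prop :=
  idealr_closed [in M] /\
  forall J : set A, idealr_closed [in J] -> M `<=` J -> J = M.

Definition vanishing_at (R : realType) (gamma : unit_itv R) : set (C01 R) :=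
  [set f | f gamma = 0].

(* Main.v *)
Require Import Defs.
From mathcomp Require Import all_boot all_order all_algebra.
From mathcomp Require Import ring_quotient finmap.
From mathcomp Require Import all_classical all_reals all_analysis.

(* Every proper ideal vanishes somewhere: otherwise, by compactness, finitely
   many of its members have no common zero, and the sum of their squares is an
   invertible function. Since M_a is not contained in M_b for a <> b (look at
   x - a), the maximal ideals are exactly the M_gamma.
   A prime ideal is contained in at most one M_gamma: for a < b, the positive
   and negative parts of x - (a + b)/2 have product 0, so one of them lies in
   the prime ideal, but the first does not vanish at b, nor the second at a. *)

Local Open Scope classical_set_scope.

Section prime_ideals_of_C01.
Set Implicit Arguments.
Unset Strict Implicit.
Import Order.TTheory GRing.Theory Num.Theory.
Import numFieldNormedType.Exports.
Local Open Scope ring_scope.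

Section ideals.
Context {A : comNzRingType} {I : {pred A}} (idI : idealr_closed I).

Lemma idealr_closed_mul (a u : A) : u \in I -> a * u \in I.
Proof. by case: idI => I0 _ ID uI; rewrite -[a * u]addr0 ID. Qed.

Lemma idealr_closed_add (u v : A) : u \in I -> v \in I -> u + v \in I.
Proof. by case: idI => _ _ ID uI vI; rewrite -[u]mul1r ID. Qed.

Lemma idealr_closed_sum (T : Type) (s : seq T) (Q : pred T) (F : T -> A) :
  (forall i, Q i -> F i \in I) -> \sum_(i <- s | Q i) F i \in I.
Proof.
case: (idI) => I0 _ _ FI.
by elim/big_ind : _ => // u v; exact: idealr_closed_add.
Qed.

Lemma idealr_closed_unit (a u : A) : a * u = 1 -> u \notin I.
Proof.
case: (idI) => _ I1 _ au; apply: contra I1 => uI.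
by rewrite -au idealr_closed_mul.
Qed.

End ideals.

Context {R : realType}.
Implicit Types (f g : C01 R) (a b x y : unit_itv R).

Let evalM f g x : (f * g) x = f x * g x. Proof. by []. Qed.

Lemma C01_evaluate_sum (T : Type) (s : seq T) (F : T -> C01 R) x :
  (\sum_(i <- s) F i) x = \sum_(i <- s) F i x.
Proof. exact: (big_morph (fun f : C01 R => f x)). Qed.

Lemma clamp_in_unit_itv (t : R) :
  Num.max 0 (Num.min t 1) \in (`[0, 1]%classic : set R).
Proof.
by apply/mem_set; rewrite /= in_itv /= le_max lexx /= ge_max ler01 ge_min lexx orbT.
Qed.

(** A retraction of the line onto the interval: composing with it extends an element of [C01 R] to
    the whole line, where compactness of the segment is available. *)
Definition clamp (t : R) : unit_itv R := SigSub (clamp_in_unit_itv t).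

Lemma clamp_continuous : continuous clamp.
Proof.
(* The interval carries the topology induced by [val], so continuity is tested after composing with
   [val]. *)
apply: continuous_comp_initial => t.
have : {for t, continuous ((cst 0 : R -> R^o) \max (id \min cst 1))}.
  apply: continuous_max; first exact: cvg_cst.
  by apply: continuous_min; [exact: cvg_id|exact: cvg_cst].
exact.
Qed.

Lemma clampK x : clamp (val x) = x.
Proof.
apply: val_inj => /=; have := set_valP x; rewrite /= in_itv /= => /andP[x0 x1].
by rewrite (min_idPl x1) (max_idPr x0).
Qed.

Lemma C01_unit f : (forall x, f x != 0) -> exists g, g * f = 1.
Proof.
move=> f0.
have cinv : continuous (fun x => (f x)^-1).
  by move=> x; apply: continuousV => //; exact: C01_cts.
by exists (mkcts cinv); apply: C01_eqP => x; rewrite evalM /= mulVf.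
Qed.

Lemma proper_ideal_vanishes (I : set (C01 R)) :
  idealr_closed [in I] -> exists a, I `<=` vanishing_at a.
Proof.
move=> idI; apply: contrapT => noa.
have nz x : exists2 f, I f & f x != 0.
  apply: contrapT => nf; apply: noa; exists x => f If; apply/eqP.
  by apply: contrapT => /negP fx; apply: nf; exists f.
have := @segment_compact R 0 1; rewrite compact_cover.
(* The cover is indexed by the ideal itself, so a finite subcover is a finite set [D] of members of
   [I]. *)
move=> /(_ _ I (fun f => [set t | f (clamp t) != 0])) [].
- move=> f _; apply: (@open_comp _ _ (f \o clamp) [set s : R | s != 0]); last first.
    exact: open_neq.
  move=> t _; apply: continuous_comp; first exact: clamp_continuous.
  exact: C01_cts.
- by move=> t _; have [f If ft] := nz (clamp t); exists f.
move=> D DI cov; pose h : C01 R := \sum_(f <- D) f * f.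
have hI : h \in [in I].
  rewrite /h big_seq_cond; apply: idealr_closed_sum => // f /andP[fD _].
  exact/idealr_closed_mul/DI.
have [x|g gh] := @C01_unit h; last first.
  by move: hI; apply/negP; exact: idealr_closed_unit gh.
(* Some [f] in [D] is nonzero at [x]: its square is split off as a positive term, and the remaining
   squares are nonnegative. *)
have [f fD /=] := cov _ (set_valP x); rewrite clampK => fx.
rewrite C01_evaluate_sum gt_eqF// (big_rem f fD) /= ltr_pwDl //.
  by rewrite evalM -expr2 exprn_even_gt0.
by apply: sumr_ge0 => g _; rewrite evalM -expr2 sqr_ge0.
Qed.

Lemma vanishing_at_idealr_closed a : idealr_closed [in vanishing_at a].
Proof.
split.
- exact/mem_set.
- by apply/negP => /set_mem /eqP; rewrite /= oner_eq0.
move=> f g h /set_mem /= ga /set_mem /= ha; apply/mem_set.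
by transitivity (f a * g a + h a); rewrite // ga ha mulr0 addr0.
Qed.

Lemma unit_itv_val_continuous : continuous (fun x => val x : R).
Proof. exact: initial_continuous. Qed.

Lemma vanishing_at_inj a b : vanishing_at a `<=` vanishing_at b -> a = b.
Proof.
have cts : continuous (fun x => val x - val a : R).
  by move=> x; exact: (cvgB (@unit_itv_val_continuous x) (cvg_cst _)).
move=> /(_ (mkcts cts) (subrr _)) ba; apply/esym/val_inj/eqP.
by rewrite -subr_eq0; exact/eqP.
Qed.

(** A proper ideal [J] above [M_a] lies in some [M_b]; then [a = b], and [J] is squeezed between two
    copies of [M_a]. *)
Lemma vanishing_at_maximal a : maximal_ideal (vanishing_at a).
Proof.
split; first exact: vanishing_at_idealr_closed.
move=> J idJ aJ; have [b Jb] := proper_ideal_vanishes idJ.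
apply/seteqP; split=> //.
by rewrite (vanishing_at_inj (subset_trans aJ Jb)).
Qed.

Lemma maximal_idealP (M : set (C01 R)) :
  maximal_ideal M -> exists a, M = vanishing_at a.
Proof.
move=> [idM maxM]; have [a Ma] := proper_ideal_vanishes idM.
by exists a; rewrite (maxM _ (vanishing_at_idealr_closed a) Ma).
Qed.

Lemma prime_ideal_vanishing_uniq (P : set (C01 R)) a b :
  prime_ideal P -> P `<=` vanishing_at a -> P `<=` vanishing_at b -> a = b.
Proof.
move=> [[P0 _ _] prP]; wlog ab : a b / val a < val b => [wl|] Pa Pb.
  have [ab|ba|/val_inj//] := ltgtP (val a) (val b); first exact: wl.
  by apply/esym; exact: wl.
(* The midpoint lies strictly between [a] and [b], so [pos] is positive at [b] and [neg] is positive
   at [a]. *)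
pose m := (val a + val b) / 2.
have maxc0 (h : unit_itv R -> R) : continuous h ->
    continuous (fun x => Num.max (h x) 0).
  move=> hc x.
  exact: (@continuous_max _ _ h (cst 0) x (hc x) (@cst_continuous _ R 0 x)).
have cpos : continuous (fun x => Num.max (val x - m) 0).
  apply: maxc0 => x.
  exact: (cvgB (@unit_itv_val_continuous x) (cvg_cst _)).
have cneg : continuous (fun x => Num.max (m - val x) 0).
  apply: maxc0 => x.
  exact: (cvgB (cvg_cst _) (@unit_itv_val_continuous x)).
pose pos : C01 R := mkcts cpos; pose neg : C01 R := mkcts cneg.
have pn0 : pos * neg = 0.
  apply: C01_eqP => x; rewrite evalM.
  have [xm|mx] := leP (val x) m.
    have -> : pos x = 0 by apply/max_idPr; rewrite subr_le0.
    exact: mul0r.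
  have -> : neg x = 0 by apply/max_idPr; rewrite subr_le0 ltW.
  exact: mulr0.
have := prP pos neg; rewrite pn0 => /(_ P0) /orP[] /set_mem.
  by move/Pb => /max_idPr; rewrite subr_le0 leNgt midf_lt.
by move/Pa => /max_idPr; rewrite subr_le0 leNgt midf_lt.
Qed.

End prime_ideals_of_C01.

Theorem mainTheorem2 (R : realType) (P : set (C01 R)) :
  prime_ideal P -> ~ maximal_ideal P ->
  exists M : set (C01 R),
    unique (fun N : set (C01 R) => maximal_ideal N /\ P `<=` N) M /\
    exists gamma : unit_itv R, M = vanishing_at gamma /\ P `<` M.
Proof.
move=> prP nmaxP; have [idP _] := prP.
have [a Pa] := proper_ideal_vanishes idP.
exists (vanishing_at a); split.
  split; first by split=> //; exact: vanishing_at_maximal.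
  (* Any competitor is some [M_b], and a prime ideal has at most one common zero. *)
  move=> N [/maximal_idealP[b ->] Pb].
  by rewrite (prime_ideal_vanishing_uniq prP Pa Pb).
(* The reverse inclusion would make [P] equal to [M_a], hence maximal. *)
exists a; split=> //; split=> // aP; apply: nmaxP.
suff -> : P = vanishing_at a by exact: vanishing_at_maximal.
exact/seteqP.
Qed.
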